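(* Let $\lambda>0$, let $m$ be a positive integer, and let $\hat{A}_\lambda=mA_\lambda$, where $A_\lambda$ is a Poisson random variable with mean $\lambda$. For a function $f:\mathbb{Z}_{\ge 0}\to\mathbb{R}$ define $$(\mathcal{A}f)(w)=\lambda m f(w+m)-wf(w),\qquad w\in\mathbb{Z}_{\ge0}.$$ Then $E[(\mathcal{A}f)(\hat{A}_\lambda)]=0$ for all bounded functions $f:\mathbb{Z}_{\ge 0}\to\mathbb{R}$.
   Context: $\mathbb{Z}_{\ge 0}$ denotes the set of nonnegative integers. *)

(* Defs.v *)
From HB Require Import structures.
From mathcomp Require Import all_boot all_order all_algebra.
From mathcomp Require Import all_classical all_reals all_analysis.

Set Implicit Arguments.
Unset Strict Implicit.
Unset Printing Implicit Defensive.

Import Order.TTheory GRing.Theory Num.Theory.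
Import numFieldNormedType.Exports.

Local Open Scope classical_set_scope.
Local Open Scope ring_scope.

(* Here nat carries its discrete sigma-algebra. The second argument 0 of
   poisson_prob is a dummy: the library's definition does not use it. *)
Definition is_poisson (R : realType) (d : measure_display)
    (T : measurableType d) (P : probability T R) (lambda : R)
    (A : {RV P >-> nat}) : Prop :=
  forall U : set nat, distribution P A U = poisson_prob lambda 0 U.
Arguments is_poisson {R d T} P lambda A.

Definition stein_op (R : realType) (lambda : R) (m : nat) (f : nat -> R)
    (w : nat) : R :=
  lambda * m%:R * f (w + m)%N - w%:R * f w.

(* Main.v *)
(* The Poisson weights p satisfy (k + 1) p (k + 1) = lambda p k, so shifting the
   series gives E[lambda g(A + 1)] = E[A g(A)] for g >= 0 (possibly both +oo),
   hence for every g by splitting into positive and negative parts. The theorem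
   is the case g k = m f(m k), where boundedness of f makes both sides finite. *)

Require Import Defs.
From HB Require Import structures.
From mathcomp Require Import all_boot all_order all_algebra.
From mathcomp Require Import all_classical all_reals all_analysis.
From mathcomp Require Import measurable_realfun.

Set Implicit Arguments.
Unset Strict Implicit.
Unset Printing Implicit Defensive.

Import Order.TTheory GRing.Theory Num.Theory.
Import numFieldNormedType.Exports.

Local Open Scope classical_set_scope.
Local Open Scope ring_scope.

(** [nat] is the countable disjoint union of its singletons and [h] is constant on each;
    nonnegativity lets the integral be summed over them. *)
Lemma ge0_integral_nat (R : realType) (mu : {measure set nat -> \bar R})
    (h : nat -> \bar R) : (forall k, 0 <= h k)%E ->
  (\int[mu]_k h k = \sum_(k <oo) h k * mu [set k])%E.
Proof.
move=> h0.
have -> : [set: nat] = \bigcup_k [set k].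
  by apply/seteqP; split=> // k _; exists k.
rewrite ge0_integral_bigcup//; last by move=> i j _ _ [x [-> ->]].
apply: eq_eseriesr => k _.
rewrite (eq_integral (cst (h k))); last by move=> x; rewrite inE => ->.
by rewrite integral_cst.
Qed.

(** The factor k + 1 cancels against (k + 1)!, and one [lambda] splits off the power. Positivity
    selects the exponential branch of [poisson_pmf]. *)
Lemma poisson_pmfS (R : realType) (lambda : R) (k : nat) : 0 < lambda ->
  k.+1%:R * poisson_pmf lambda k.+1 = lambda * poisson_pmf lambda k.
Proof.
move=> l0; rewrite /poisson_pmf l0 !mulrA; congr (_ * _).
rewrite factS natrM invfM exprS -!mulrA mulrCA; congr (_ * _).
by rewrite mulrCA mulVKf// pnatr_eq0.
Qed.

Section stein_chen.
Context (R : realType) (lambda : R) (d : measure_display)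
  (T : measurableType d) (P : probability T R) (A : {RV P >-> nat}).
Hypotheses (lambda_gt0 : 0 < lambda) (A_poisson : is_poisson P lambda A).
Implicit Types g : nat -> R.

Lemma measurable_fun_comp_nat g :
  measurable_fun [set: T] (EFin \o (g \o A)).
Proof.
apply/measurable_EFinP.
by apply: (@measurableT_comp _ _ _ _ _ _ g _ A).
Qed.

(** Passing to the law of [A] gives an integral over [nat], in which the singleton of [k] has mass
    [poisson_pmf lambda k]. *)
Lemma ge0_expectation_poisson g : (forall k, 0 <= g k) ->
  (\int[P]_x (g (A x))%:E =
   \sum_(k <oo) (g k * poisson_pmf lambda k)%:E)%E.
Proof.
move=> g0.
rewrite -(@ge0_integral_distribution _ _ _ _ _ _ A (EFin \o g))//=.
rewrite ge0_integral_nat; last by move=> k; rewrite lee_fin.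
apply: eq_eseriesr => k _.
rewrite EFinM; congr (_ * _)%E; rewrite [LHS](A_poisson [set k]).
by rewrite /poisson_prob lambda_gt0 esum_set1// lee_fin poisson_pmf_ge0.
Qed.

Lemma ge0_poisson_shift g : (forall k, 0 <= g k) ->
  (\int[P]_x (lambda * g (A x).+1)%:E = \int[P]_x ((A x)%:R * g (A x))%:E)%E.
Proof.
move=> g0; have l0 := ltW lambda_gt0.
rewrite (ge0_expectation_poisson (g := fun k => lambda * g k.+1)); last first.
  by move=> k; rewrite mulr_ge0.
rewrite (ge0_expectation_poisson (g := fun k => k%:R * g k)); last first.
  by move=> k; rewrite mulr_ge0.
(* The factor [k] kills the term at 0, so the right-hand series may start at 1 and be reindexed to
   match the left one. *)
rewrite [RHS]nneseries_recl//; last first.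
  by move=> k _; rewrite lee_fin !mulr_ge0// poisson_pmf_ge0.
rewrite !mul0r add0e -nneseries_addn; last first.
  by move=> k; rewrite lee_fin !mulr_ge0// poisson_pmf_ge0.
apply: eq_eseriesr => k _; congr EFin.
by rewrite mulrAC -poisson_pmfS// addn1 mulrAC.
Qed.

Lemma poisson_shift g :
  (\int[P]_x (lambda * g (A x).+1)%:E = \int[P]_x ((A x)%:R * g (A x))%:E)%E.
Proof.
have l0 := ltW lambda_gt0.
(* Matching the positive and negative parts separately gives equality even when they are infinite.
   The factors [lambda] and [A x] are nonnegative, hence move through the maxima. *)
rewrite integralE [RHS]integralE; congr (_ - _)%E.
- under eq_integral => x _.
    rewrite funeposE -EFin_max -(mulr0 lambda) -maxr_pMr//.
    over.
  rewrite (ge0_poisson_shift (g := fun k => Num.max (g k) 0)); last first.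
    by move=> k; rewrite le_max lexx orbT.
  by apply: eq_integral => x _; rewrite funeposE -EFin_max maxr_pMr// mulr0.
- under eq_integral => x _.
    rewrite funenegE -EFinN -EFin_max -mulrN -(mulr0 lambda) -maxr_pMr//.
    over.
  rewrite (ge0_poisson_shift (g := fun k => Num.max (- g k) 0)); last first.
    by move=> k; rewrite le_max lexx orbT.
  apply: eq_integral => x _.
  by rewrite funenegE -EFinN -EFin_max maxr_pMr// mulr0 mulrN.
Qed.

Lemma poisson_shift_integrable g : bounded_fun g ->
  P.-integrable setT (fun x => (lambda * g (A x).+1)%:E).
Proof.
move=> [M [_ Mg]].
(* Boundedness provides bounds only at reals strictly above [M]; |M| + 1 is such a real and is
   nonnegative. *)
apply: (@le_integrable _ _ _ _ _ measurableT _
  (EFin \o cst (lambda * (`|M| + 1)))) => //.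
- exact: (measurable_fun_comp_nat (fun k => lambda * g k.+1)).
- move=> x _ /=; rewrite lee_fin !normrM; apply: ler_wpM2l => //.
  rewrite [leRHS]ger0_norm ?addr_ge0//.
  by apply: Mg => //; rewrite (le_lt_trans (ler_norm _))// ltrDl.
- exact: finite_measure_integrable_cst.
Qed.

(** The integrand may be unbounded, but the shift identity for |g| equates the integral of its
    absolute value with that of lambda |g(A + 1)|, which is finite. *)
Lemma poisson_mul_integrable g : bounded_fun g ->
  P.-integrable setT (fun x => ((A x)%:R * g (A x))%:E).
Proof.
move=> bg; apply/integrableP; split.
  exact: (measurable_fun_comp_nat (fun k => k%:R * g k)).
under eq_integral => x _ do rewrite abse_EFin normrM ger0_norm//.
rewrite -(ge0_poisson_shift (g := fun k => `|g k|))//.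
have /integrableP[_] := poisson_shift_integrable bg.
congr (_ < _)%E; apply: eq_integral => x _.
by rewrite abse_EFin normrM (ger0_norm (ltW lambda_gt0)).
Qed.

End stein_chen.

Theorem lemma2p1 (R : realType) (lambda : R) (m : nat)
    (lambda_gt0 : 0 < lambda) (m_gt0 : (0 < m)%N)
    (d : measure_display) (T : measurableType d) (P : probability T R)
    (A : {RV P >-> nat}) (A_poisson : is_poisson P lambda A) :
  forall f : nat -> R, bounded_fun f ->
    ('E_P[fun x : T => stein_op lambda m f (m * A x)%N] = 0)%E.
Proof.
move=> f [M [Mreal Mf]]; pose g k := m%:R * f (m * k)%N.
have bg : bounded_fun g.
  exists (m%:R * (`|M| + 1)); split; first exact: num_real.
  move=> y yM k _; apply: (le_trans _ (ltW yM)).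
  rewrite normrM ger0_norm// ler_wpM2l//.
  by apply: Mf => //; rewrite (le_lt_trans (ler_norm _))// ltrDl.
rewrite unlock.
under eq_integral => x _.
  (* Here m A + m = m (A + 1), and the factor m of the weight w = m A is absorbed into [g]. *)
  rewrite (_ : stein_op _ _ _ _ =
    lambda * g (A x).+1 - (A x)%:R * g (A x)); last first.
    by rewrite /stein_op /g mulnS addnC natrM !mulrA [m%:R * _]mulrC.
  rewrite EFinB.
  over.
rewrite integralB//; last 2 first.
- exact: poisson_shift_integrable.
- exact: (poisson_mul_integrable lambda_gt0 A_poisson).
(* The two integrals agree, but their difference is 0 in the extended reals only because
   integrability makes them finite. *)
have gA := poisson_shift_integrable lambda A bg.
rewrite -(poisson_shift lambda_gt0 A_poisson) subee//.
exact: integrable_fin_num gA.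
Qed.
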